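(* Let $\mathbb{D}$ be the unit disc, $\mathbb{T}$ its boundary, and let $b$ be in the closed unit ball of $H^\infty(\mathbb{D})$. (i) Let $\varphi$ be a parabolic automorphism of $\mathbb{D}$ with fixed point $\xi\in\mathbb{T}$. If $H(b)=(z-\xi)H^2\oplus\mathbb{C}$, then the composition operator $C_\varphi f=f\circ\varphi$ is bounded from $H(b)$ to $H(b)$. (ii) Let $\varphi$ be a hyperbolic automorphism of $\mathbb{D}$ with fixed points $\xi_1,\xi_2\in\mathbb{T}$. If $H(b)=(z-\xi_1)(z-\xi_2)H^2\oplus\mathbb{P}_1$, then $C_\varphi f=f\circ\varphi$ is bounded from $H(b)$ to $H(b)$.
   Context: $H^2=H^2(\mathbb{D})$ is the classical Hardy space; $T_\psi f=P_+(\psi f)$ is the Toeplitz operator; $H(b)$ is the range of $(I-T_bT_{\overline b})^{1/2}$ with norm $\|(I-T_bT_{\overline b})^{1/2}f\|_b=\|f\|_2$ for $f\perp\ker(I-T_bT_{\overline b})^{1/2}$. $\mathbb{P}_1$ is the space of polynomials of degree at most $1$. A parabolic automorphism of $\mathbb{D}$ is a non-identity disc automorphism with exactly one fixed point in $\overline{\mathbb{D}}$, lying on $\mathbb{T}$; a hyperbolic automorphism is one with two distinct fixed points, both on $\mathbb{T}$. *)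

(* Defs.v *)
(* MathComp + MathComp-Analysis; complex numbers are R[i] (real-closed's
   `complex`) over an abstract R : realType. *)
From mathcomp Require Import all_boot all_order all_algebra.
From mathcomp Require Import all_classical all_reals all_analysis.
From mathcomp Require Import complex.
Set Implicit Arguments. Unset Strict Implicit. Unset Printing Implicit Defensive.
Import Order.TTheory GRing.Theory Num.Theory.
Import numFieldNormedType.Exports.
Local Open Scope ring_scope.

(* The complex numbers. *)
Definition Cplx (R : realType) : numClosedFieldType := R[i].

Section HardyDefs.
Variable R : realType.
Local Notation C := (Cplx R).

(* open unit disc D *)
Definition disc (z : C) : Prop := `|z| < 1.

(* Sequences (Taylor coefficients) are elements of nat -> C.
   H^2 is identified isometrically with l^2(N) via Taylor coefficients. *)
Definition sqsum (a : nat -> C) : C := limn (series (fun n => `|a n| ^+ 2)).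
Definition l2 (a : nat -> C) : Prop := cvgn (series (fun n => `|a n| ^+ 2)).
Definition inner (a c : nat -> C) : C := limn (series (fun n => a n * (c n)^*)).

(* value at z of the power series with coefficients a *)
Definition psum (a : nat -> C) (z : C) : C := limn (series (fun n => a n * z ^+ n)).

(* b lies in the closed unit ball of H^oo(D): b is (the coefficient sequence of)
   a holomorphic function on D with sup_D |b| <= 1. *)
Definition Hinf_ball (b : nat -> C) : Prop :=
  forall z, disc z -> cvgn (series (fun n => b n * z ^+ n)) /\ `|psum b z| <= 1.

(* f : C -> C belongs to H^2 (only the values on D matter) *)
Definition inH2 (f : C -> C) : Prop :=
  exists a, l2 a /\ forall z, disc z -> f z = psum a z.

(* Toeplitz operators in Fourier coefficients:
   T_b a = P_+(b a): (T_b a)_n = sum_{k<=n} b_k a_{n-k};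
   T_{conj b} a = P_+(conj(b) a): (T_{conj b} a)_n = sum_{j>=0} conj(b_j) a_{n+j}. *)
Definition Tb (b a : nat -> C) : nat -> C :=
  fun n => \sum_(k < n.+1) b k * a (n - k)%N.
Definition Tbbar (b a : nat -> C) : nat -> C :=
  fun n => limn (series (fun j => (b j)^* * a (n + j)%N)).

(* (I - T_b T_{conj b}) a *)
Definition defect (b a : nat -> C) : nat -> C :=
  fun n => a n - Tb b (Tbbar b a) n.

(* S is the (positive) square root (I - T_b T_{conj b})^{1/2}: a bounded linear,
   positive operator on H^2 = l^2 whose square is I - T_b T_{conj b}.
   (The positive square root of a positive operator is unique.) *)
Definition is_sqrt_defect (b : nat -> C) (S : (nat -> C) -> (nat -> C)) : Prop :=
  [/\ (forall a, l2 a -> l2 (S a)),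
      (forall (c : C) a a', l2 a -> l2 a' ->
          S (fun n => c * a n + a' n) = (fun n => c * S a n + S a' n)),
      (exists M : C, forall a, l2 a -> sqsum (S a) <= M * sqsum a),
      (forall a, l2 a -> 0 <= inner (S a) a) &
      ((forall a a', l2 a -> l2 a' -> inner (S a) a' = inner a (S a')) /\
      (forall a, l2 a -> S (S a) = defect b a))].

(* a is orthogonal to ker S *)
Definition perp_ker (S : (nat -> C) -> (nat -> C)) (a : nat -> C) : Prop :=
  forall k, l2 k -> S k = (fun=> 0) -> inner a k = 0.

(* f belongs to H(b) = range of S (as functions on D) *)
Definition inHb (S : (nat -> C) -> (nat -> C)) (f : C -> C) : Prop :=
  exists a, l2 a /\ forall z, disc z -> f z = psum (S a) z.

(* C_phi f = f o phi is bounded from H(b) to H(b), where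
   ||S a||_b = ||a||_2 for a orthogonal to ker S. *)
Definition Cphi_bounded_Hb (S : (nat -> C) -> (nat -> C)) (phi : C -> C) : Prop :=
  exists M : C, 0 <= M /\
    forall a, l2 a -> perp_ker S a ->
      exists a', [/\ l2 a', perp_ker S a',
        (forall z, disc z -> psum (S a') z = psum (S a) (phi z)) &
        sqsum a' <= M * sqsum a].

(* automorphisms of D: z |-> lam (z - w)/(1 - conj(w) z), |lam| = 1, |w| < 1
   (prescribed on the closed disc, where the formula is the continuous extension) *)
Definition disc_aut (phi : C -> C) : Prop :=
  exists lam w : C, [/\ `|lam| = 1, `|w| < 1 &
    forall z, `|z| <= 1 -> phi z = lam * (z - w) / (1 - w^* * z)].

Definition non_identity (phi : C -> C) : Prop := exists z, disc z /\ phi z != z.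

(* parabolic automorphism with (unique) fixed point xi in the closed disc, xi in T *)
Definition parabolic_aut (phi : C -> C) (xi : C) : Prop :=
  [/\ disc_aut phi, non_identity phi, `|xi| = 1 &
      forall z, `|z| <= 1 -> (phi z = z <-> z = xi)].

(* hyperbolic automorphism with two distinct fixed points xi1, xi2, both on T *)
Definition hyperbolic_aut (phi : C -> C) (xi1 xi2 : C) : Prop :=
  [/\ disc_aut phi, xi1 != xi2, `|xi1| = 1 /\ `|xi2| = 1 &
      forall z, `|z| <= 1 -> (phi z = z <-> z = xi1 \/ z = xi2)].

(* (z - xi) H^2 (+) C *)
Definition shift1_space (xi : C) (f : C -> C) : Prop :=
  exists g c, inH2 g /\ forall z, disc z -> f z = (z - xi) * g z + c.

(* (z - xi1)(z - xi2) H^2 (+) P_1 *)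
Definition shift2_space (xi1 xi2 : C) (f : C -> C) : Prop :=
  exists g c0 c1, inH2 g /\
    forall z, disc z -> f z = (z - xi1) * (z - xi2) * g z + (c0 + c1 * z).

End HardyDefs.

(* Main.v *)
(** The hypothesis on [H(b)] is used only to see that it is invariant under
    [C_phi]; boundedness is then automatic.  The graph
    [{(a, a') | S a' = (S a) o phi}] is a closed linear relation in l^2 x l^2 with
    full domain, so a closed graph argument gives for each [a] some [a'] with
    [||a'|| <= M ||a||], and replacing [a'] by its minimal-norm representative makes
    it orthogonal to [ker S].

    Invariance: writing [w] for the zero of [phi] and [e = lam (1 - |w|^2) / (1 - w^* z)],
    the weighted operator [g |-> e (g o phi)] preserves H^2, since it maps the powers
    of [z] to the orthogonal system [e phi^n]; and for a fixed point [xi] one has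
    [phi z - xi = (z - xi) e(z) / (1 - w^* xi)], so the factor [z - xi] of the function
    comes back multiplied by exactly the required weight.  In the hyperbolic case one
    also needs [1 / (1 - w^* z)] to multiply H^2 into itself and
    [phi z - z = (z - xi1) (z - xi2) w^* / (1 - w^* z)]. *)
Require Import Defs.
From mathcomp Require Import all_boot all_order all_algebra.
From mathcomp Require Import all_classical all_reals all_analysis.
From mathcomp Require Import complex.
From mathcomp Require Import ring lra.
Set Implicit Arguments. Unset Strict Implicit. Unset Printing Implicit Defensive.
Import Order.TTheory GRing.Theory Num.Theory.
Import numFieldNormedType.Exports.
Local Open Scope ring_scope.
Local Open Scope classical_set_scope.

(** * Complex numbers as pairs of reals *)

Section ComplexModulus.
Variable R : realType.
Local Notation C := (Cplx R).
Local Notation "x %:C" := (real_complex R x : C) (format "x %:C").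

(** The squared modulus as an element of the ordered field [R]: the norm [|z|] takes its values in
    [C], whose order is only partial, so estimates are carried out on [nsq]. *)
Definition nsq (z : C) : R := complex.Re z ^+ 2 + complex.Im z ^+ 2.

Lemma nsq_ge0 z : 0 <= nsq z.
Proof. by rewrite /nsq addr_ge0 ?sqr_ge0. Qed.

Lemma norm_nsq (z : C) : `|z| ^+ 2 = (nsq z)%:C.
Proof. by rewrite /nsq -add_Re2_Im2. Qed.

Lemma nsq0 : nsq 0 = 0.
Proof. by rewrite /nsq /= expr0n /= addr0. Qed.

Lemma nsqM a b : nsq (a * b) = nsq a * nsq b.
Proof. by case: a b => [x y] [u v]; rewrite /nsq /=; ring. Qed.

Lemma nsqN a : nsq (- a) = nsq a.
Proof. by case: a => [x y]; rewrite /nsq /=; ring. Qed.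

(** Multiplying by a nonzero [a] turns either conjugate into [|a|^2]. This gives access to the
    coordinates of [a^*]. *)
Lemma conjE (a : C) : a^* = conjc a.
Proof.
have [->|a0] := eqVneq a 0; first by rewrite !rmorph0.
by apply: (mulfI a0); rewrite -normCK.
Qed.

Lemma nsq_conj (a : C) : nsq a^* = nsq a.
Proof. by rewrite conjE; case: a => [x y]; rewrite /nsq /=; ring. Qed.

Lemma nsq_eq0 a : (nsq a == 0) = (a == 0).
Proof.
case: a => [x y]; rewrite /nsq /= paddr_eq0 ?sqr_ge0 // !sqrf_eq0.
by rewrite eq_complex.
Qed.

Lemma nsqV (a : C) : nsq a^-1 = (nsq a)^-1.
Proof.
have [->|a0] := eqVneq a 0; first by rewrite invr0 nsq0 invr0.
have h : nsq a != 0 by rewrite nsq_eq0.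
apply: (mulfI h); rewrite -nsqM !divff //.
by rewrite /nsq /= expr1n expr0n /= addr0.
Qed.

Lemma nsq_parallelogram (a b : C) :
  nsq (a + b) + nsq (a - b) = 2 * nsq a + 2 * nsq b.
Proof. by case: a b => [x y] [u v]; rewrite /nsq /=; ring. Qed.

Lemma nsqD_le (a b : C) : nsq (a + b) <= 2 * nsq a + 2 * nsq b.
Proof. by rewrite -nsq_parallelogram lerDl nsq_ge0. Qed.

Lemma ReM_le (a b : C) : `|complex.Re (a * b)| <= nsq a + nsq b.
Proof.
case: a b => [x y] [u v]; rewrite /nsq /= ler_norml.
have := sqr_ge0 (x - u); have := sqr_ge0 (x + u).
have := sqr_ge0 (y - v); have := sqr_ge0 (y + v).
by move=> *; apply/andP; split; nra.
Qed.

Lemma ImM_le (a b : C) : `|complex.Im (a * b)| <= nsq a + nsq b.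
Proof.
case: a b => [x y] [u v]; rewrite /nsq /= ler_norml.
have := sqr_ge0 (x - v); have := sqr_ge0 (x + v).
have := sqr_ge0 (y - u); have := sqr_ge0 (y + u).
by move=> *; apply/andP; split; nra.
Qed.

Lemma normC_lt (z : C) (e : R) : 0 <= e -> (`|z| < e%:C) = (nsq z < e ^+ 2).
Proof.
move=> e0; rewrite -(@ltr_pXn2r _ 2) ?nnegrE ?normr_ge0 ?ler0c //.
by rewrite norm_nsq -rmorphXn /= ltcR.
Qed.

Lemma normC_le1 (z : C) : (`|z| <= 1) = (nsq z <= 1).
Proof. by rewrite -[LHS](expr_le1 (n := 2)) // norm_nsq -(rmorph1 (real_complex R)) lecR. Qed.

Lemma normC_lt1 (z : C) : (`|z| < 1) = (nsq z < 1).
Proof. by rewrite -(rmorph1 (real_complex R)) normC_lt // expr1n. Qed.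

Lemma normC_eq1 (z : C) : (`|z| = 1) -> nsq z = 1.
Proof.
move=> h; apply: (@complexI R); rewrite -norm_nsq h expr1n.
by rewrite rmorph1.
Qed.

Lemma posC (e : C) : 0 < e -> exists2 d : R, 0 < d & e = d%:C.
Proof.
case: e => x y; rewrite ltcE /= => /andP[/eqP y0 x0].
by exists x => //; rewrite y0.
Qed.

Lemma norm_lt_of_sqr (x e : R) : 0 < e -> x ^+ 2 < e ^+ 2 -> `|x| < e.
Proof.
move=> e0 h; rewrite -(@ltr_pXn2r _ 2) ?nnegrE ?normr_ge0 ?ltW //.
by rewrite real_normK ?num_real.
Qed.

Lemma cvgC_ReIm (u : nat -> C) (l : C) :
  (u @ \oo --> l) <->
  ((fun n => complex.Re (u n)) @ \oo --> complex.Re l) /\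
  ((fun n => complex.Im (u n)) @ \oo --> complex.Im l).
Proof.
split.
- move=> h; split; apply/cvgrPdist_lt => e e0;
  have /cvgrPdist_lt/(_ e%:C) := h; rewrite ltcR => /(_ e0);
  apply: filterS => n; rewrite normC_lt ?ltW //; case: l {h} => x y;
  case: (u n) => x' y'; rewrite /nsq /= => h; apply: norm_lt_of_sqr => //;
  apply: le_lt_trans h; rewrite ?lerDl ?lerDr ?sqr_ge0 //.
- move=> [h1 h2]; apply/cvgrPdist_lt => e /posC[d d0 ->].
  have d2 : 0 < d / 2 by rewrite divr_gt0.
  move/cvgrPdist_lt: h1 => /(_ _ d2); move/cvgrPdist_lt: h2 => /(_ _ d2).
  apply: filterS2 => n; rewrite normC_lt ?ltW //; case: l => x y.
  by case: (u n) => x' y'; rewrite /nsq /= !ltr_norml => /andP[? ?] /andP[? ?]; nra.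
Qed.

Lemma cvg_limC (u : nat -> C) (l : C) : u @ \oo --> l -> limn u = l.
Proof. by move=> h; rewrite (cvg_lim _ h). Qed.

Lemma cvgC_nsq (u : nat -> C) (l : C) :
  (u @ \oo --> l) <-> ((fun n => nsq (u n - l)) @ \oo --> (0 : R)).
Proof.
split.
- move=> h; apply/cvgrPdist_lt => e e0.
  have s0 : 0 < Num.sqrt e by rewrite sqrtr_gt0.
  have /cvgrPdist_lt/(_ (Num.sqrt e)%:C) := h; rewrite ltcR => /(_ s0).
  apply: filterS => n; rewrite normC_lt ?ltW // sqr_sqrtr ?ltW // => hn.
  by rewrite sub0r normrN ger0_norm ?nsq_ge0 // -nsqN opprB.
- move=> h; apply/cvgrPdist_lt => e /posC[d d0 ->].
  have d2 : 0 < d ^+ 2 by rewrite exprn_gt0.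
  move/cvgrPdist_lt: h => /(_ _ d2).
  apply: filterS => n; rewrite normC_lt ?ltW // sub0r normrN ger0_norm ?nsq_ge0 //.
  by rewrite -nsqN opprB.
Qed.

(** Real and imaginary parts converge by comparison with [t], and each limit is at most the sum of
    [t]; adding the two squares produces the factor 2. *)
Lemma cvg_bounded_seriesC (a : nat -> C) (t : nat -> R) :
  (forall n, `|complex.Re (a n)| <= t n) -> (forall n, `|complex.Im (a n)| <= t n) ->
  cvgn (series t) ->
  cvgn (series a) /\ nsq (limn (series a)) <= 2 * limn (series t) ^+ 2.
Proof.
move=> hr hi ct.
have t0 n : 0 <= t n by apply: le_trans (hr n).
have aux (x : nat -> R) : (forall n, `|x n| <= t n) ->
    cvgn (series x) /\ `|limn (series x)| <= limn (series t).
  move=> hx; have cn : cvgn [normed series x].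
    by apply: series_le_cvg ct => // n /=.
  split; first exact: normed_cvg.
  apply: le_trans (lim_series_norm cn) _.
  by apply: ler_lim => //; near=> n; apply: ler_sum => i _; exact: hx.
have [cr lr] := aux _ hr; have [ci li] := aux _ hi.
have ReS n : complex.Re (series a n) = series (fun n => complex.Re (a n)) n.
  rewrite /series /=; elim: n => [|n IH]; first by rewrite !big_geq.
  by rewrite !big_nat_recr //= -IH; case: (\sum_(_ <= _ < _) _) (a n) => ? ? [].
have ImS n : complex.Im (series a n) = series (fun n => complex.Im (a n)) n.
  rewrite /series /=; elim: n => [|n IH]; first by rewrite !big_geq.
  by rewrite !big_nat_recr //= -IH; case: (\sum_(_ <= _ < _) _) (a n) => ? ? [].
pose l : C := Complex (limn (series (fun n => complex.Re (a n))))
  (limn (series (fun n => complex.Im (a n)))).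
have al : series a @ \oo --> l.
  apply/cvgC_ReIm; rewrite (funext ReS) (funext ImS).
  by split.
split; first by apply/cvg_ex; exists l.
rewrite (cvg_lim _ al) //; rewrite /nsq /=.
move: lr li; rewrite !ler_norml => /andP[? ?] /andP[? ?].
by nra.
Unshelve. all: by end_near. Qed.

Lemma cvgC_cauchy (u : nat -> C) :
  (forall e : R, 0 < e -> exists N, forall m n, (N <= m)%N -> (N <= n)%N ->
     nsq (u m - u n) <= e) -> cvgn u.
Proof.
move=> h.
have aux (f : C -> R) : (forall z w, f (z - w) = f z - f w) ->
   (forall z, f z ^+ 2 <= nsq z) -> cvgn (fun n => f (u n)).
  move=> fB fn; apply/cauchy_cvgP/cauchy_exP => e e0.
  have [|N hN] := h (e ^+ 2 / 2); first by rewrite divr_gt0 // exprn_gt0.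
  exists (f (u N)); exists N => // n /= Nn.
  rewrite /ball /= -fB.
  have := le_trans (fn _) (hN N n (leqnn N) Nn).
  by move=> h1; apply: norm_lt_of_sqr => //; have := exprn_gt0 2 e0; lra.
have cr : cvgn (fun n => complex.Re (u n)).
  by apply: aux => [[? ?] [? ?]//|[? ?]]; rewrite /nsq /= lerDl sqr_ge0.
have ci : cvgn (fun n => complex.Im (u n)).
  by apply: aux => [[? ?] [? ?]//|[? ?]]; rewrite /nsq /= lerDr sqr_ge0.
apply/cvg_ex; exists (Complex (limn (fun n => complex.Re (u n)))
  (limn (fun n => complex.Im (u n)))).
by apply/cvgC_ReIm.
Qed.

End ComplexModulus.

(** * Closed linear relations in complete quadratic spaces *)

Section ClosedRelation.
Variables (R : realType) (V : lmodType (Cplx R)) (H : V -> Prop) (q : V -> R).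
Local Notation C := (Cplx R).
Local Notation "x %:C" := (real_complex R x : C) (format "x %:C").

(* [q] plays the role of a squared norm on the subspace [H]; its values outside
   [H] are junk. *)
Record complete_quadratic : Prop := CompleteQuadratic {
  cq0 : H 0;
  cq_lin : forall (c : C) a b, H a -> H b -> H (c *: a + b);
  cq_ge0 : forall a, 0 <= q a;
  cqZ : forall (c : C) a, H a -> q (c *: a) = nsq c * q a;
  cq_par : forall a b, H a -> H b -> q (a + b) + q (a - b) = 2 * q a + 2 * q b;
  cq_tri : forall t a b, 0 < t -> H a -> H b ->
    q (a + b) <= (1 + t) * q a + (1 + t^-1) * q b;
  cq_complete : forall u : nat -> V, (forall n, H (u n)) ->
    (forall e : R, 0 < e -> exists N, forall m n, (N <= m)%N -> (N <= n)%N ->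
       q (u m - u n) <= e) ->
    exists2 l, H l &
      forall e : R, 0 < e -> exists N, forall n, (N <= n)%N -> q (l - u n) <= e }.

Hypothesis HQ : complete_quadratic.

Let H0 := cq0 HQ.
Let q_ge0 := cq_ge0 HQ.

Lemma cqD a b : H a -> H b -> H (a + b).
Proof. by move=> ha hb; rewrite -[a]scale1r; exact: cq_lin. Qed.

Lemma cqZ_in (c : C) a : H a -> H (c *: a).
Proof. by move=> ha; rewrite -[_ *: _]addr0; exact: cq_lin. Qed.

Lemma cqN a : H a -> H (- a).
Proof. by move=> ha; rewrite -scaleN1r; exact: cqZ_in. Qed.

Lemma cqB a b : H a -> H b -> H (a - b).
Proof. by move=> ha hb; apply: cqD => //; exact: cqN. Qed.

Lemma q_zero : q 0 = 0.
Proof. by rewrite -(scale0r 0) (cqZ HQ) // nsq0 mul0r. Qed.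

Lemma q_opp a : H a -> q (- a) = q a.
Proof.
move=> ha; rewrite -scaleN1r (cqZ HQ) // nsqN.
by rewrite /nsq /= expr1n expr0n /= addr0 mul1r.
Qed.

Lemma q_sym a b : H a -> H b -> q (a - b) = q (b - a).
Proof. by move=> ha hb; rewrite -q_opp ?opprB //; exact: cqB. Qed.

(** The case [t = 1] of [cq_tri]. It stands in for the triangle inequality of squared norms at the
    price of a factor 2. *)
Lemma q_quasi a b : H a -> H b -> q (a + b) <= 2 * q a + 2 * q b.
Proof.
by move=> ha hb; have := cq_tri HQ ltr01 ha hb; rewrite invr1 -(natrD _ 1 1).
Qed.

Lemma q_quasiB a b c : H a -> H b -> H c ->
  q (a - c) <= 2 * q (a - b) + 2 * q (b - c).
Proof.
move=> ha hb hc; have -> : a - c = (a - b) + (b - c) by rewrite addrA subrK.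
by apply: q_quasi; exact: cqB.
Qed.

Lemma nsq_real (t : R) : nsq t%:C = t ^+ 2.
Proof. by rewrite /nsq /= expr0n /= addr0. Qed.

Lemma geometric_small (d : nat -> R) : (forall n, d n.+1 <= d n / 16) ->
  forall e : R, 0 < e -> exists n, d n <= e.
Proof.
move=> dd e e0.
have dn n : d n <= d 0%N / 16 ^+ n.
  elim: n => [|n IH]; first by rewrite expr0 divr1.
  apply: le_trans (dd n) _; rewrite exprSr invfM mulrA.
  by rewrite ler_pM2r // invr_gt0.
have /archi_boundP : 0 <= `|d 0%N| / e by rewrite divr_ge0 // ltW.
set n := Num.bound _ => hn; exists n; apply: le_trans (dn n) _.
rewrite ler_pdivrMr ?exprn_gt0 //.
apply: le_trans (ler_norm _) _; rewrite mulrC -ler_pdivrMr //.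
apply: le_trans (ltW hn) _.
rewrite -natrX ler_nat; apply: ltnW; exact: ltn_expl.
Qed.

(** The ratio 1/16 absorbs the factors 2 of [q_quasi]: [2 * 4 d_(n+1) + 2 d_n <= 4 d_n], so all
    later terms stay within [4 d_n] of [u n], and passing to the limit doubles this once more. *)
Lemma fast_limit (u : nat -> V) (d : nat -> R) : (forall n, H (u n)) ->
  (forall n, d n.+1 <= d n / 16) -> (forall n, q (u n.+1 - u n) <= d n) ->
  exists2 l, H l & forall n, q (l - u n) <= 8 * d n.
Proof.
move=> Hu dd ud.
have d0 n : 0 <= d n by apply: le_trans (ud n).
have step m : forall n, q (u (n + m)%N - u n) <= 4 * d n.
  elim: m => [|m IH] n; first by rewrite addn0 subrr q_zero mulr_ge0.
  have := q_quasiB (Hu (n + m.+1)%N) (Hu n.+1) (Hu n).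
  have := IH n.+1; rewrite addSnnS; have := ud n; have := dd n; have := d0 n.
  by lra.
have stepd n m : (n <= m)%N -> q (u m - u n) <= 4 * d n.
  by move=> nm; rewrite -(subnKC nm).
have [|l Hl ul] := cq_complete HQ Hu.
  move=> e e0; have [|N hN] := geometric_small dd (e := e / 16).
    by rewrite divr_gt0.
  exists N => m n Nm Nn; have := q_quasiB (Hu m) (Hu N) (Hu n).
  rewrite (q_sym (Hu N)) //; have := stepd _ _ Nm; have := stepd _ _ Nn.
  by lra.
exists l => // n; apply/ler_addgt0Pr => e e0.
have [|N hN] := ul (e / 2); first by rewrite divr_gt0.
have := q_quasiB Hl (Hu (maxn N n)) (Hu n).
have := hN _ (leq_maxl N n); have := stepd _ _ (leq_maxr N n).
by lra.
Qed.

Variable Rel : V -> V -> Prop.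
Hypothesis Rel0 : Rel 0 0.
Hypothesis Rel_lin : forall (c : C) a a' b b', H a -> H a' -> H b -> H b' ->
  Rel a a' -> Rel b b' -> Rel (c *: a + b) (c *: a' + b').
Hypothesis Rel_closed : forall l l', H l -> H l' ->
  (forall e : R, 0 < e -> exists u u', [/\ H u, H u', Rel u u', q (l - u) <= e &
     q (l' - u') <= e]) -> Rel l l'.
Hypothesis Rel_total : forall a, H a -> exists2 a', H a' & Rel a a'.

Let RelD a a' b b' : H a -> H a' -> H b -> H b' ->
  Rel a a' -> Rel b b' -> Rel (a + b) (a' + b').
Proof.
by move=> *; rewrite -[a]scale1r -[a']scale1r; exact: Rel_lin.
Qed.

Let RelZ (c : C) a a' : H a -> H a' -> Rel a a' -> Rel (c *: a) (c *: a').
Proof.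
by move=> *; rewrite -[c *: a]addr0 -[c *: a']addr0; exact: Rel_lin.
Qed.

Let RelB a a' b b' : H a -> H a' -> H b -> H b' ->
  Rel a a' -> Rel b b' -> Rel (a - b) (a' - b').
Proof.
move=> ha ha' hb hb' r r'; apply: RelD => //; try exact: cqN.
by rewrite -[- b]scaleN1r -[- b']scaleN1r; exact: RelZ.
Qed.

(** That is, [y] lies in the closure of the set of points related to some element of size at most
    [B]. *)
Definition approximable (y : V) (B : R) := forall e : R, 0 < e ->
  exists a a', [/\ H a, H a', Rel a a', q a' <= B & q (y - a) <= e].

(* Baire category: otherwise one picks nested balls, the n-th one avoiding all
   points with a preimage of size at most n. *)
Lemma approximable_on_ball : exists (B : R) x d,
  [/\ 0 <= B, H x, 0 < d & forall y, H y -> q (y - x) <= d -> approximable y B].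
Proof.
apply: contrapT => notB.
(* A pair [s] is a ball, given by its centre and squared radius. Its validity is kept as a premise
   of the conclusion, so that plain choice gives a total step function which can be iterated. *)
have avoid (n : nat) (s : V * R) : exists s' : V * R, H s.1 -> 0 < s.2 ->
    [/\ H s'.1, 0 < s'.2, s'.2 <= s.2 / 16, q (s'.1 - s.1) <= s.2 &
     forall a a', H a -> H a' -> Rel a a' -> q (s'.1 - a) <= 8 * s'.2 ->
       n%:R < q a'].
  have [[Hs s0]|] := pselect (H s.1 /\ 0 < s.2); last first.
    by move=> ns; exists s => ? ?; case: ns.
  apply: contrapT => no; apply: notB; exists n%:R, s.1, s.2; split => //.
  move=> y Hy ys e e0; apply: contrapT => noa; apply: no.
  (* The bound [e / 8] turns the avoided distance [8 * s'.2] into at most [e]; the bound [s.2 / 16]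
     is the decay demanded by [fast_limit]. *)
  exists (y, Num.min (e / 8) (s.2 / 16)) => _ _ /=; split => //.
  - by rewrite lt_min !divr_gt0.
  - by rewrite ge_min lexx orbT.
  move=> a a' Ha Ha' r qya; rewrite ltNge; apply/negP => qn; apply: noa.
  exists a, a'; split => //; apply: le_trans qya _.
  have : Num.min (e / 8) (s.2 / 16) <= e / 8 by rewrite ge_min lexx.
  by set m := Num.min _ _; lra.
have /choice[next nextP] : forall ns : nat * (V * R), exists s' : V * R, 
    H ns.2.1 -> 0 < ns.2.2 ->
    [/\ H s'.1, 0 < s'.2, s'.2 <= ns.2.2 / 16, q (s'.1 - ns.2.1) <= ns.2.2 &
     forall a a', H a -> H a' -> Rel a a' -> q (s'.1 - a) <= 8 * s'.2 ->
       ns.1%:R < q a'].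
  by move=> [n s]; exact: avoid.
pose s := fix s n := if n is m.+1 then next (m, s m) else (0, 1).
have sP n : H (s n).1 /\ 0 < (s n).2.
  elim: n => [|n [h1 h2]]; first by split => /=.
  by have [] := nextP (n, s n) h1 h2.
have sN n := nextP (n, s n) (sP n).1 (sP n).2.
have [|n|n|l Hl ul] := @fast_limit (fun n => (s n).1) (fun n => (s n).2).
- by move=> n; case: (sP n).
- by have [] := sN n.
- by have [] := sN n.
(* The common limit [l] is related to some [l'], but stage [n] forces [n < q l']; the contradiction
   comes from a stage [n] above [q l']. *)
have [l' Hl' r] := Rel_total Hl.
have [_ _ _ _ /(_ l l' Hl Hl' r)] := sN (Num.bound (q l')).
rewrite q_sym //; last by case: (sP (Num.bound (q l')).+1).
move=> /(_ (ul (Num.bound (q l')).+1)) /=.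
by rewrite ltNge ltW // archi_boundP.
Qed.

(** Writing [y = (x + y) - x] moves the ball to the origin and costs a factor 4 in the bound;
    homogeneity of [q] then spreads the estimate from [q y <= d] to all [y]. *)
Lemma approximable_bounded : exists2 K : R, 0 <= K &
  forall y, H y -> approximable y (K * q y).
Proof.
have [B [x [d [B0 Hx d0 ball]]]] := approximable_on_ball.
exists (4 * B / d); first by rewrite divr_ge0 ?mulr_ge0 // ltW.
have small y : H y -> q y <= d -> approximable y (4 * B).
  move=> Hy yd e e0; have e4 : 0 < e / 4 by rewrite divr_gt0.
  have [||a1 [a1' [h1 h1' r1 q1 d1]]] := ball (x + y) _ _ _ e4.
  - exact: cqD.
  - by rewrite addrC addKr.
  have [||a2 [a2' [h2 h2' r2 q2 d2]]] := ball x _ _ _ e4 => //.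
  - by rewrite subrr q_zero ltW.
  exists (a1 - a2), (a1' - a2'); split; [exact: cqB|exact: cqB|exact: RelB| |].
  - have := q_quasi h1' (cqN h2'); rewrite q_opp //.
    by lra.
  - have -> : y - (a1 - a2) = (x + y - a1) - (x - a2).
      rewrite !opprB [x + y]addrC -!addrA; congr (_ + _).
      by rewrite addrCA [x + _]addrC subrK addrC.
    have hx : H (x - a2) by exact: cqB.
    have := q_quasi (cqB (cqD Hx Hy) h1) (cqN hx); rewrite q_opp //.
    by lra.
move=> y Hy e e0; have := q_ge0 y; rewrite le_eqVlt => /orP[/eqP y0|y0].
  exists 0, 0; split => //; first by rewrite -y0 mulr0 q_zero.
  by rewrite subr0 -y0 ltW.
(* Chosen so that [q (t y) = d], the edge of the ball. *)
pose t := Num.sqrt (d / q y).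
have dy : 0 < d / q y by rewrite divr_gt0.
have t0 : 0 < t by rewrite sqrtr_gt0.
have t2 : t ^+ 2 = d / q y by rewrite sqr_sqrtr // ltW.
have tC : t%:C != 0 by rewrite -nsq_eq0 nsq_real expf_neq0 // gt_eqF.
have qt c : H c -> q (t^-1%:C *: c) = q c * (q y / d).
  by move=> Hc; rewrite (cqZ HQ) // nsq_real exprVn t2 invf_div mulrC.
have := @small (t%:C *: y) (cqZ_in _ Hy).
rewrite (cqZ HQ) // nsq_real t2 divfK ?gt_eqF // lexx => /(_ isT).
have et : 0 < e * (d / q y) by rewrite mulr_gt0.
move=> /(_ _ et)[a [a' [Ha Ha' r qa ya]]].
exists (t^-1%:C *: a), (t^-1%:C *: a'); split; try exact: cqZ_in.
- exact: RelZ.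
- rewrite qt // -[leRHS]mulrA [_^-1 * _]mulrC.
  by rewrite ler_pM2r // divr_gt0.
- have -> : y - t^-1%:C *: a = t^-1%:C *: (t%:C *: y - a).
    rewrite scalerBr scalerA -rmorphM /= mulVf ?gt_eqF // rmorph1 scale1r //.
  rewrite qt; last by apply: cqB => //; exact: cqZ_in.
  by rewrite -ler_pdivlMr ?invf_div // divr_gt0.
Qed.

(** Successive approximation: the remainder [y - s.1] is approximated again and again, with error
    [c / 16^k] after [k] rounds. The images [s.2] then move by at most [K c / 16^k], hence converge,
    and closedness relates [y] to their limit. *)
Lemma closed_relation_bounded : exists2 M : R, 0 <= M &
  forall y, H y -> exists y', [/\ H y', Rel y y' & q y' <= M * q y].
Proof.
have [K K0 app] := approximable_bounded.
exists (8 * K); first by rewrite mulr_ge0.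
move=> y Hy; have := q_ge0 y; rewrite le_eqVlt => /orP[/eqP y0|c0].
  exists 0; split => //; last by rewrite -y0 mulr0 q_zero.
  apply: Rel_closed => // e e0; exists 0, 0; split => //.
  - by rewrite subr0 -y0 ltW.
  - by rewrite subr0 q_zero ltW.
set c := q y in c0 *.
pose inv (k : nat) (s : V * V) :=
  [/\ H s.1, H s.2, Rel s.1 s.2 & q (y - s.1) <= c / 16 ^+ k].
have /choice[next nextP] : forall ks : nat * (V * V), exists s' : V * V,
    inv ks.1 ks.2 -> inv ks.1.+1 s' /\ q (s'.2 - ks.2.2) <= K * (c / 16 ^+ ks.1).
  move=> [k [s s']] /=; have [i|ni] := pselect (inv k (s, s')); last first.
    by exists (s, s') => /ni.
  case: i => /= Hs Hs' r ys.
  have ek : 0 < c / 16 ^+ k.+1 by rewrite divr_gt0 ?exprn_gt0.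
  have [a [a' [Ha Ha' ra qa ya]]] := app _ (cqB Hy Hs) _ ek.
  exists (s + a, s' + a') => _; split.
    by split=> /=; [exact: cqD|exact: cqD|exact: RelD|rewrite opprD addrA].
  rewrite /= addrC addKr; apply: le_trans qa _.
  by apply: ler_wpM2l.
pose s := fix s n := if n is m.+1 then next (m, s m) else (0, 0).
have sI n : inv n (s n).
  elim: n => [|n IH]; first by split=> //=; rewrite subr0 expr0 divr1.
  by have [] := nextP (n, s n) IH.
have sN n := (nextP (n, s n) (sI n)).2.
have geo (k : R) n : k * (c / 16 ^+ n.+1) <= k * (c / 16 ^+ n) / 16.
  by rewrite exprSr invfM !mulrA.
have [|n|n|l Hl ul] := @fast_limit (fun n => (s n).2) (fun n => K * (c / 16 ^+ n)).
- by move=> n; case: (sI n).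
- exact: geo.
- exact: sN.
exists l; split => //.
  apply: Rel_closed => // e e0.
  (* The constant [8 * K + 1] makes one [n] serve both errors, [8 K c / 16^n] for the images and
     [c / 16^n] for the points. *)
  have [n hn] := @geometric_small (fun n => (8 * K + 1) * (c / 16 ^+ n)) (geo _) e e0.
  have cn : 0 < c / 16 ^+ n by rewrite divr_gt0 ?exprn_gt0.
  have Kn : 0 <= K * (c / 16 ^+ n) by rewrite mulr_ge0 // ltW.
  exists (s n).1, (s n).2; have [h1 h2 r ys] := sI n; split => //.
  - by lra.
  - by have := ul n; lra.
(* The sequence of images starts at 0, so the estimate at index 0 bounds the limit itself. *)
have := ul 0%N; rewrite /= subr0 expr0 divr1.
by rewrite mulrA.
Qed.

(** * Representatives of minimal norm *)

Definition minimal_rep (v : V) := forall k, H k -> Rel 0 k -> q v <= q (v + k).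

(** A minimizing sequence is Cauchy by the parallelogram law, because midpoints of elements related
    to [a] are again related to [a]. Its limit is related to [a] by closedness and attains the
    infimum by [cq_tri] with small [t]. *)
Lemma exists_minimal_rep a a' : H a -> H a' -> Rel a a' ->
  exists v, [/\ H v, Rel a v, q v <= q a' & minimal_rep v].
Proof.
move=> Ha Ha' r.
pose A := [set x | exists v, [/\ H v, Rel a v & x = q v]].
have A0 : has_inf A.
  split; first by exists (q a'), a'.
  by exists 0 => _ [v [_ _ ->]].
pose m := inf A.
have mle v : H v -> Rel a v -> m <= q v.
  by move=> Hv rv; apply: ge_inf; [case: A0|exists v].
have /choice[v vP] : forall n : nat, exists v, [/\ H v, Rel a v & q v <= m + n.+1%:R^-1].
  move=> n; have n0 : 0 < n.+1%:R^-1 :> R by rewrite invr_gt0.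
  have [_ [v [Hv rv ->]] lt] := inf_adherent n0 A0.
  by exists v; split => //; exact: ltW.
have Hv n : H (v n) by case: (vP n).
have rv n : Rel a (v n) by case: (vP n).
have qv n : q (v n) <= m + n.+1%:R^-1 by case: (vP n).
have qvN N n : (N <= n)%N -> q (v n) <= m + N.+1%:R^-1.
  move=> Nn; apply: le_trans (qv n) _; rewrite lerD2l.
  by rewrite lef_pV2 ?posrE // ler_nat.
have small (e : R) : 0 < e -> exists N : nat, N.+1%:R^-1 <= e :> R.
  move=> e0; exists (Num.bound e^-1); rewrite -[leRHS]invrK lef_pV2 ?posrE ?invr_gt0 //.
  apply: le_trans (ltW (archi_boundP _)) _; first by rewrite invr_ge0 ltW.
  by rewrite ler_nat.
have [|l Hl vl] := cq_complete HQ Hv.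
  move=> e e0; have [|N hN] := small (e / 4); first by rewrite divr_gt0.
  exists N => i j Ni Nj.
  have half : m <= q (2^-1%:C *: (v i + v j)).
    apply: mle; first by apply: cqZ_in; exact: cqD.
    have -> : a = 2^-1%:C *: (a + a).
      rewrite -[X in _ *: (X + X)]scale1r -scalerDl scalerA.
      rewrite -(rmorph1 (real_complex R)).
      have h2 : 2^-1 * (1 + 1) = 1 :> R by lra.
      by rewrite -rmorphD -rmorphM h2 rmorph1 scale1r.
    by apply: RelZ; [exact: cqD|exact: cqD|exact: RelD].
  move: half; rewrite (cqZ HQ) ?nsq_real; last exact: cqD.
  have := cq_par HQ (Hv i) (Hv j); have := qvN _ _ Ni; have := qvN _ _ Nj.
  move: hN; set N1 := _^-1; move=> *; lra.
have rl : Rel a l.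
  apply: Rel_closed => // e e0; have [N hN] := vl e e0.
  exists a, (v N); split=> //; first by rewrite subrr q_zero ltW.
  exact: hN.
have qlm : q l <= m.
  suff key (e : R) : 0 < e -> q l <= m + e by exact/ler_addgt0Pr.
  move=> e0.
  have m0 : 0 <= m by apply: lb_le_inf; [case: A0|move=> _ [w [_ _ ->]]].
  (* Three errors of at most [e / 4] each: from the factor [1 + t] on [m], from the minimizing
     sequence, and from its distance to the limit. The shift [m + 1] covers the case [m = 0]. *)
  pose t : R := e / 4 / (m + 1).
  have t0 : 0 < t by rewrite !divr_gt0 // ltr_wpDl.
  have tm : t * (m + 1) = e / 4 by rewrite divfK // gt_eqF // ltr_wpDl.
  have t1 : 0 < 1 + t by rewrite addr_gt0.
  have ti : 0 < 1 + t^-1 by rewrite addr_gt0 // invr_gt0.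
  have [|N1 hN1] := small (e / 4 / (1 + t)); first by rewrite !divr_gt0.
  have [|N2 hN2] := vl (e / 4 / (1 + t^-1)); first by rewrite !divr_gt0.
  set n := maxn N1 N2.
  have := qvN N1 n (leq_maxl _ _) => q1.
  have := hN2 n (leq_maxr _ _); rewrite ler_pdivlMr // => q2.
  have := cq_tri HQ t0 (Hv n) (cqB Hl (Hv n)); rewrite addrC subrK => q3.
  move: hN1; rewrite ler_pdivlMr // => hN1.
  have q4 : (1 + t) * q (v n) <= (1 + t) * (m + N1.+1%:R^-1) by rewrite ler_pM2l.
  have q5 (X : R) : (1 + t) * (m + X) = m + t * (m + 1) - t + X * (1 + t) by ring.
  move: q3 q4; rewrite q5 tm [_ * q (l - _)]mulrC => q3 q4.
  move: q2 q3 q4 hN1; set X := q (l - _) * _; set Y := _ * q (v n).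
  by set Z := _^-1 * _; clearbody X Y Z; clear -t0 e0; move=> *; lra.
exists l; split=> //; first by apply: le_trans qlm (mle _ _ _).
move=> k Hk rk; apply: le_trans qlm _; apply: mle; first exact: cqD.
by rewrite -[a]addr0; exact: RelD.
Qed.

End ClosedRelation.

(** * Completeness of l^2 *)

Section SquareSummable.
Variable R : realType.
Local Notation C := (Cplx R).
Local Notation "x %:C" := (real_complex R x : C) (format "x %:C").
Local Notation seqC := (nat -> C^o).

(** [psq] and [qn] are real-valued versions of the partial sums and the value of [sqsum], which live
    in [C]. *)
Definition psq (a : nat -> C) (N : nat) : R := series (fun n => nsq (a n)) N.
Definition qn (a : nat -> C) : R := limn (psq a).

Lemma psqS a N : psq a N.+1 = psq a N + nsq (a N).
Proof. by rewrite /psq /series /= big_nat_recr. Qed.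

Lemma psq0 a : psq a 0 = 0.
Proof. by rewrite /psq /series /= big_geq. Qed.

Lemma psq_ndecr a : nondecreasing_seq (psq a).
Proof.
by apply/nondecreasing_seqP => n; rewrite psqS lerDl nsq_ge0.
Qed.

Lemma psq_ge0 a N : 0 <= psq a N.
Proof. by rewrite -(psq0 a); apply: psq_ndecr. Qed.

Lemma l2P a : l2 a <-> cvgn (psq a).
Proof.
have E : series (fun n => `|a n| ^+ 2) = fun n => (psq a n)%:C.
  apply/funext; elim => [|n IH]; first by rewrite psq0 /series /= big_geq.
  by rewrite psqS rmorphD /= -IH /series /= big_nat_recr //= norm_nsq.
rewrite /l2 E; split=> [/cvg_ex[l /cvgC_ReIm[h _]]|h].
  by apply/cvg_ex; exists (complex.Re l).
apply/cvg_ex; exists (limn (psq a))%:C; apply/cvgC_ReIm; split => //=.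
exact: cvg_cst.
Qed.

Lemma cvg_psq a : l2 a -> psq a @ \oo --> qn a.
Proof. by move/l2P. Qed.

Lemma sqsumE a : l2 a -> sqsum a = (qn a)%:C.
Proof.
move=> la; rewrite /sqsum; apply: cvg_limC.
have E : series (fun n => `|a n| ^+ 2) = fun n => (psq a n)%:C.
  apply/funext; elim => [|n IH]; first by rewrite psq0 /series /= big_geq.
  by rewrite psqS rmorphD /= -IH /series /= big_nat_recr //= norm_nsq.
rewrite E; apply/cvgC_ReIm; split => /=; [exact: cvg_psq|exact: cvg_cst].
Qed.

Lemma psq_le a N : l2 a -> psq a N <= qn a.
Proof.
by move=> /l2P h; apply: nondecreasing_cvgn_le => //; exact: psq_ndecr.
Qed.

Lemma l2_bounded a (B : R) : (forall N, psq a N <= B) -> l2 a /\ qn a <= B.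
Proof.
move=> h; have ca : cvgn (psq a).
  apply: nondecreasing_is_cvgn; first exact: psq_ndecr.
  by exists B => _ [n _ <-].
split; first exact/l2P.
by apply: limr_le => //; near=> n.
Unshelve. all: by end_near. Qed.

Lemma qn_ge0 a : l2 a -> 0 <= qn a.
Proof. by move=> la; apply: le_trans (psq_le 0 la); rewrite psq0. Qed.

Lemma nsq_le_qn a n : l2 a -> nsq (a n) <= qn a.
Proof.
by move=> la; apply: le_trans (psq_le n.+1 la); rewrite psqS lerDr psq_ge0.
Qed.

(** The two sides differ by [t^-1 |t a - b|^2]. *)
Lemma nsq_tri (t : R) (a b : C) : 0 < t ->
  nsq (a + b) <= (1 + t) * nsq a + (1 + t^-1) * nsq b.
Proof.
move=> t0; rewrite -subr_ge0.
have -> : (1 + t) * nsq a + (1 + t^-1) * nsq b - nsq (a + b) =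
    t^-1 * nsq (t%:C * a - b).
  case: a b => [x y] [u v]; rewrite /nsq /=; field.
  by rewrite gt_eqF.
by rewrite mulr_ge0 ?nsq_ge0 // invr_ge0 ltW.
Qed.

Lemma psqZ (c : C) (a : seqC) N : psq (c *: a) N = nsq c * psq a N.
Proof.
elim: N => [|N IH]; first by rewrite !psq0 mulr0.
by rewrite !psqS IH mulrDr -nsqM.
Qed.

Lemma psq_par (a b : seqC) N :
  psq (a + b) N + psq (a - b) N = 2 * psq a N + 2 * psq b N.
Proof.
elim: N => [|N IH]; first by rewrite !psq0 !mulr0.
rewrite !psqS addrACA IH [X in _ + X](nsq_parallelogram (a N) (b N)).
by rewrite !mulrDr addrACA.
Qed.

Lemma psq_tri (t : R) (a b : seqC) N : 0 < t ->
  psq (a + b) N <= (1 + t) * psq a N + (1 + t^-1) * psq b N.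
Proof.
move=> t0; elim: N => [|N IH]; first by rewrite !psq0 !mulr0 addr0.
rewrite !psqS (mulrDr (1 + t)) (mulrDr (1 + t^-1)) addrACA lerD //.
exact: (nsq_tri (a N) (b N) t0).
Qed.

Lemma l2Z (c : C) (a : seqC) : l2 a -> l2 (c *: a).
Proof.
move=> la; apply: (@l2_bounded _ (nsq c * qn a) _).1 => N.
by rewrite psqZ ler_wpM2l ?nsq_ge0 // psq_le.
Qed.

Arguments l2Z _ [a].

Lemma l2D (a b : seqC) : l2 a -> l2 b -> l2 (a + b).
Proof.
move=> la lb; apply: (@l2_bounded _ ((1 + 1) * qn a + (1 + 1^-1) * qn b) _).1 => N.
apply: le_trans (psq_tri _ _ _ ltr01) _.
by rewrite lerD // ler_wpM2l ?psq_le // addr_ge0 // invr_ge0.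
Qed.

Lemma l2_0 : l2 (0 : seqC).
Proof.
apply: (@l2_bounded _ 0 _).1; elim=> [|N IH]; first by rewrite psq0.
by rewrite psqS nsq0 addr0.
Qed.

Lemma l2N (a : seqC) : l2 a -> l2 (- a).
Proof. by move=> la; rewrite -scaleN1r; exact: l2Z. Qed.

Lemma l2B (a b : seqC) : l2 a -> l2 b -> l2 (a - b).
Proof. by move=> la lb; exact: (l2D la (l2N lb)). Qed.

Lemma cvg_nsq_sub (u : nat -> C) (l c : C) :
  u @ \oo --> l -> (fun n => nsq (u n - c)) @ \oo --> nsq (l - c).
Proof.
move=> /cvgC_ReIm[hr hi]; rewrite /nsq.
have B (f : C -> R) (fB : forall z w : C, f (z - w) = f z - f w) :
    (fun n => f (u n)) @ \oo --> f l -> (fun n => f (u n - c) ^+ 2) @ \oo --> f (l - c) ^+ 2.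
  move=> h; rewrite fB; under eq_fun do rewrite fB.
  by rewrite expr2; under eq_fun do rewrite expr2; apply: cvgM; apply: cvgB => //; exact: cvg_cst.
by apply: cvgD; apply: B => // [[? ?] [? ?]].
Qed.

Lemma cvg_psq_sub (u : nat -> seqC) (l c : seqC) N :
  (forall i, u ^~ i @ \oo --> l i) ->
  (fun n => psq (u n - c) N) @ \oo --> psq (l - c) N.
Proof.
move=> h; elim: N => [|N IH].
  by rewrite psq0; under eq_fun do rewrite psq0; exact: cvg_cst.
rewrite psqS; under eq_fun do rewrite psqS.
by apply: cvgD => //; exact: cvg_nsq_sub.
Qed.

(* The absolute value only serves to make the junk value of [qn] outside l^2
   nonnegative. *)
Lemma l2_complete_quadratic : complete_quadratic (@l2 R : seqC -> Prop) (fun a => `|qn a|).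
Proof.
have qE a : l2 a -> `|qn a| = qn a by move=> la; rewrite ger0_norm // qn_ge0.
split.
- exact: l2_0.
- by move=> c a b la lb; exact: (l2D (l2Z c la) lb).
- by move=> a; exact: normr_ge0.
- move=> c a la; rewrite !qE; [|exact: la|exact: l2Z].
  apply: (cvg_lim (@Rhausdorff R)).
  rewrite (_ : psq _ = fun n => nsq c * psq a n); last by apply/funext => n; rewrite psqZ.
  by apply: cvgMr; exact: cvg_psq.
- move=> a b la lb; rewrite (qE _ la) (qE _ lb) (qE _ (l2D la lb)) (qE _ (l2B la lb)).
  have h1 : (fun n => psq (a + b) n + psq (a - b) n) @ \oo --> qn (a + b) + qn (a - b).
    exact: (cvgD (cvg_psq (l2D la lb)) (cvg_psq (l2B la lb))).
  have h2 : (fun n => 2 * psq a n + 2 * psq b n) @ \oo --> 2 * qn a + 2 * qn b.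
    by apply: cvgD; apply: cvgMr; exact: cvg_psq.
  rewrite (_ : (fun n => psq (a + b) n + _) = (fun n => 2 * psq a n + 2 * psq b n)) in h1.
    exact: (cvg_unique (@Rhausdorff R) h1 h2).
  by apply/funext => n; exact: psq_par.
- move=> t a b t0 la lb; rewrite (qE _ la) (qE _ lb) (qE _ (l2D la lb)).
  apply: (@l2_bounded _ _ _).2 => N.
  apply: le_trans (psq_tri _ _ _ t0) _.
  by rewrite lerD // ler_wpM2l ?psq_le // addr_ge0 // ?invr_ge0 ltW.
(* Completeness: coordinates converge, and for a fixed cut-off [M] the Cauchy estimate survives the
   limit in the first index. As the bound does not depend on [M], it holds for the full norm. *)
- move=> u lu cu.
  have cu' (e : R) : 0 < e -> exists N, forall m n, (N <= m)%N -> (N <= n)%N ->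
      forall M, psq (u m - u n) M <= e.
    move=> /cu[N hN]; exists N => m n Nm Nn M.
    apply: le_trans (hN m n Nm Nn); rewrite qE; last exact: l2B.
    by apply: psq_le; exact: l2B.
  have ci i : cvgn (u ^~ i).
    apply: cvgC_cauchy => e /cu'[N hN]; exists N => m n Nm Nn.
    by apply: le_trans (hN m n Nm Nn i.+1); rewrite psqS lerDr psq_ge0.
  pose l : seqC := fun i => limn (u ^~ i).
  have main (e : R) : 0 < e -> exists N, forall n, (N <= n)%N ->
      l2 (l - u n) /\ qn (l - u n) <= e.
    move=> /cu'[N hN]; exists N => n Nn; apply: l2_bounded => M.
    have h := @cvg_psq_sub u l (u n) M ci.
    rewrite -(cvg_lim (@Rhausdorff R) h); apply: limr_le.
      by apply/cvg_ex; eexists; exact: h.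
    by exists N => // m /= Nm; exact: hN.
  exists l.
    have [N /(_ N (leqnn N))[hN _]] := main 1 ltr01.
    by rewrite -(subrK (u N) l); exact: (l2D hN (lu N)).
  move=> e /main[N hN]; exists N => n /hN[h1 h2]; rewrite qE //.
Qed.

End SquareSummable.

(** * Power series and the inner product *)

Section PowerSeries.
Variable R : realType.
Local Notation C := (Cplx R).
Local Notation "x %:C" := (real_complex R x : C) (format "x %:C").
Local Notation seqC := (nat -> C^o).

Definition pconv (a : nat -> C) (z : C) := cvgn (series (fun n => a n * z ^+ n)).

(** The value [2 / (1 - |z|)^2]: the squared sum of the geometric series in [|z|], times the factor
    2 of [cvg_bounded_seriesC]. *)
Definition disc_bound (z : C) : R := 2 / (1 - Num.sqrt (nsq z)) ^+ 2.

Lemma sqrt_nsq_lt1 (z : C) : disc z -> Num.sqrt (nsq z) < 1.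
Proof.
by rewrite /disc normC_lt1 => h; rewrite -sqrtr1 ltr_sqrt.
Qed.

Lemma disc_bound_ge0 (z : C) : 0 <= disc_bound z.
Proof. by rewrite divr_ge0 ?sqr_ge0. Qed.

Lemma nsqX (z : C) n : nsq (z ^+ n) = nsq z ^+ n.
Proof.
elim: n => [|n IH]; last by rewrite !exprS nsqM IH.
by rewrite !expr0 /nsq /= expr1n expr0n /= addr0.
Qed.

Lemma Re_le_sqrt (z : C) : `|complex.Re z| <= Num.sqrt (nsq z).
Proof. by rewrite -sqrtr_sqr ler_wsqrtr // lerDl sqr_ge0. Qed.

Lemma Im_le_sqrt (z : C) : `|complex.Im z| <= Num.sqrt (nsq z).
Proof. by rewrite -sqrtr_sqr ler_wsqrtr // lerDr sqr_ge0. Qed.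

Lemma psum_bounded (a : nat -> C) (B : R) (z : C) : disc z ->
  (forall n, nsq (a n) <= B) ->
  pconv a z /\ nsq (psum a z) <= disc_bound z * B.
Proof.
move=> dz aB; have B0 : 0 <= B by apply: le_trans (aB 0%N); exact: nsq_ge0.
set x := Num.sqrt (nsq z).
have x0 : 0 <= x by exact: sqrtr_ge0.
have x1 : `|x| < 1 by rewrite ger0_norm //; exact: sqrt_nsq_lt1.
have key n : Num.sqrt (nsq (a n * z ^+ n)) <= geometric (Num.sqrt B) x n.
  rewrite nsqM sqrtrM ?nsq_ge0 // /geometric /= ler_pM ?sqrtr_ge0 //.
    exact: ler_wsqrtr.
  rewrite nsqX; have -> : nsq z = x ^+ 2 by rewrite sqr_sqrtr // nsq_ge0.
  by rewrite -exprM mulnC exprM sqrtr_sqr ger0_norm // exprn_ge0.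
have cg := cvg_geometric_series x1 (a := Num.sqrt B).
have lg := cvg_lim (@Rhausdorff R) cg.
have [|||h1 h2] := @cvg_bounded_seriesC R (fun n => a n * z ^+ n) (geometric (Num.sqrt B) x).
- by move=> n; apply: le_trans (key n); exact: Re_le_sqrt.
- by move=> n; apply: le_trans (key n); exact: Im_le_sqrt.
- by apply/cvg_ex; eexists; exact: cg.
split; first exact: h1.
apply: le_trans h2 _; rewrite lg exprMn sqr_sqrtr // exprVn /disc_bound.
by rewrite [B * _]mulrC mulrA.
Qed.

Lemma pconv_l2 (a : nat -> C) z : disc z -> l2 a -> pconv a z.
Proof.
by move=> dz la; have [] := psum_bounded dz (fun n => nsq_le_qn n la).
Qed.

(** Evaluation at a point of the disc is continuous on H^2, since every coefficient is dominated by
    the norm. This is what makes the composition relation closed. *)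
Lemma psum_l2_le (a : nat -> C) z : disc z -> l2 a ->
  nsq (psum a z) <= disc_bound z * qn a.
Proof.
by move=> dz la; have [] := psum_bounded dz (fun n => nsq_le_qn n la).
Qed.

Lemma psum_cvg (a : nat -> C) z : pconv a z ->
  series (fun n => a n * z ^+ n) @ \oo --> psum a z.
Proof. by []. Qed.

Lemma psum_eq (a : nat -> C) z (l : C) :
  series (fun n => a n * z ^+ n) @ \oo --> l -> pconv a z /\ psum a z = l.
Proof.
by move=> h; split; [apply/cvg_ex; exists l|exact: cvg_limC].
Qed.

Lemma psum_lin (c : C) (a b : nat -> C) z : pconv a z -> pconv b z ->
  pconv (fun n => c * a n + b n) z /\
  psum (fun n => c * a n + b n) z = c * psum a z + psum b z.
Proof.
move=> pa pb; apply: psum_eq.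
have -> : series (fun n => (c * a n + b n) * z ^+ n) =
    (fun n => c * series (fun n => a n * z ^+ n) n + series (fun n => b n * z ^+ n) n).
  apply/funext; elim => [|n IH].
    by rewrite /series /= !big_geq // mulr0 addr0.
  rewrite /series /= !big_nat_recr //=; move: IH; rewrite /series /= => ->.
  by rewrite mulrDl mulrDr -!addrA -mulrA; congr (_ + _); rewrite addrCA.
have h := cvgD (cvgM (cvg_cst c) (psum_cvg pa)) (psum_cvg pb).
exact: h.
Qed.

(** The Taylor coefficients of [c + z a(z)]. *)
Definition pshift (c : C) (a : nat -> C) : nat -> C :=
  fun n => if n is m.+1 then a m else c.

Lemma psum_shift (c : C) (a : nat -> C) z : pconv a z ->
  pconv (pshift c a) z /\ psum (pshift c a) z = c + z * psum a z.
Proof.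
move=> pa; apply: psum_eq; rewrite -(cvg_shiftS (series _)) /=.
have -> : (fun n => series (fun n => pshift c a n * z ^+ n) n.+1) =
    (fun n => c + z * series (fun n => a n * z ^+ n) n).
  apply/funext => n; rewrite /series /= big_nat_recl //= expr0 mulr1; congr (_ + _).
  by rewrite mulr_sumr; apply: eq_bigr => i _; rewrite exprS mulrCA.
have h := cvgD (cvg_cst c) (cvgM (cvg_cst z) (psum_cvg pa)).
exact: h.
Qed.

Lemma psum_ext (a b : nat -> C) z : (forall n, a n = b n) -> psum a z = psum b z.
Proof. by move=> /funext ->. Qed.

Lemma pconv_inner (a c : nat -> C) : l2 a -> l2 c ->
  series (fun n => a n * (c n)^*) @ \oo --> inner a c.
Proof.
move=> la lc; rewrite /inner.
have [|||h _] := @cvg_bounded_seriesC R (fun n => a n * (c n)^*) (fun n => nsq (a n) + nsq (c n)).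
- by move=> n; rewrite -(nsq_conj (c n)); exact: ReM_le.
- by move=> n; rewrite -(nsq_conj (c n)); exact: ImM_le.
- have h := cvgD (cvg_psq la) (cvg_psq lc).
  apply/cvg_ex; exists (qn a + qn c).
  suff -> : series (fun n => nsq (a n) + nsq (c n)) = (fun n => psq a n + psq c n) by exact: h.
  by apply/funext => n; rewrite /psq /series /= big_split.
- exact: h.
Qed.

Lemma nsqD_scale (t x y : C) :
  nsq (x + t * y) = nsq x + nsq t * nsq y + 2 * complex.Re (t^* * (x * y^*)).
Proof.
by rewrite !conjE; case: t x y => [a b] [c d] [e f]; rewrite /nsq /=; ring.
Qed.

Lemma qn_add_scale (t : C) (a k : seqC) : l2 a -> l2 k ->
  qn (a + t *: k) = qn a + nsq t * qn k + 2 * complex.Re (t^* * inner a k).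
Proof.
move=> la lk.
have h := cvg_psq (l2D la (l2Z (c := t) lk)).
have hi : (fun n => t^* * series (fun n => a n * (k n)^*) n) @ \oo --> t^* * inner a k.
  exact: (cvgM (cvg_cst t^*) (pconv_inner la lk)).
move/cvgC_ReIm: hi => [hi _].
have h2 : (fun n => psq a n + nsq t * psq k n +
     2 * complex.Re (t^* * series (fun n => a n * (k n)^*) n)) @ \oo -->
   qn a + nsq t * qn k + 2 * complex.Re (t^* * inner a k).
  apply: cvgD; last by apply: cvgMr.
  by apply: cvgD; [exact: cvg_psq|apply: cvgMr; exact: cvg_psq].
rewrite (_ : (fun n => _) = psq (a + t *: k)) in h2.
  exact: (cvg_unique (@Rhausdorff R) h h2).
apply/funext; elim => [|n IH].
  by rewrite !psq0 /series /= big_geq // !mulr0 /= !addr0.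
rewrite !psqS -IH /series /= big_nat_recr //= (mulrDr t^*).
have -> : nsq ((a + t *: k) n) = nsq (a n + t * k n) by [].
rewrite nsqD_scale.
move: (\sum_(_ <= _ < n) _) => s; move: (t^* * s) (t^* * (a n * (k n)^*)).
by case=> [x1 y1] [x2 y2] /=; ring.
Qed.

(** With [s = inner a k], testing [t = - u s] gives [0 <= u^2 |s|^2 qn k - 2 u |s|^2] for every real
    [u]; the choice [u = 1 / (qn k + 1)] forces [s = 0], also when [qn k = 0]. *)
Lemma inner_minimal (a k : seqC) : l2 a -> l2 k ->
  (forall t : C, qn a <= qn (a + t *: k)) -> inner a k = 0.
Proof.
move=> la lk h; set s := inner a k; apply/eqP; rewrite -nsq_eq0.
have key (u : R) : 0 <= u ^+ 2 * nsq s * qn k - 2 * u * nsq s.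
  have := h (- (u%:C * s)); rewrite qn_add_scale // -/s.
  have -> : nsq (- (u%:C * s)) = u ^+ 2 * nsq s by rewrite nsqN nsqM nsq_real.
  have -> : complex.Re ((- (u%:C * s))^* * s) = - (u * nsq s).
    by rewrite !conjE; case: s => x y; rewrite /nsq /=; ring.
  by lra.
have q0 := qn_ge0 lk; have s0 := nsq_ge0 s.
have := key (qn k + 1)^-1.
have k1 : 0 < qn k + 1 by rewrite ltr_wpDl.
set v := (qn k + 1)^-1; have v0 : 0 < v by rewrite invr_gt0.
have vk : v * (qn k + 1) = 1 by rewrite mulVf // gt_eqF.
have -> : v ^+ 2 * nsq s * qn k - 2 * v * nsq s =
    v * nsq s * (v * (qn k + 1)) - v ^+ 2 * nsq s - 2 * (v * nsq s) by ring.
rewrite vk => hh.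
have hv : 0 <= v ^+ 2 * nsq s by rewrite mulr_ge0 // exprn_ge0 // ltW.
have : v * nsq s <= 0 by lra.
by rewrite pmulr_rle0 // => s1; rewrite eq_le s1 s0.
Qed.

End PowerSeries.

(** * Composition with disc automorphisms *)

Section Resolvent.
Variable R : realType.
Local Notation C := (Cplx R).
Local Notation "x %:C" := (real_complex R x : C) (format "x %:C").
Local Notation seqC := (nat -> C^o).

Lemma psum_sub (a b : seqC) z : disc z -> l2 a -> l2 b ->
  psum (a - b) z = psum a z - psum b z.
Proof.
move=> dz la lb.
have [_ h] := psum_lin (-1) (pconv_l2 dz lb) (pconv_l2 dz la).
rewrite [RHS]addrC -[- psum b z]mulN1r -h; apply: psum_ext => n.
by rewrite mulN1r addrC.
Qed.

Lemma psum_cvg_l2 (u : nat -> seqC) (l : seqC) z : disc z ->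
  (forall n, l2 (u n)) -> l2 l ->
  (forall e : R, 0 < e -> exists N, forall n, (N <= n)%N -> `|qn (l - u n)| <= e) ->
  (fun n => psum (u n) z) @ \oo --> psum l z.
Proof.
move=> dz lu ll h; apply/cvgC_nsq/cvgrPdist_lt => e e0.
have K0 := disc_bound_ge0 z.
have K1 : 0 < disc_bound z + 1 by rewrite ltr_wpDl.
have [|N hN] := h (e / 2 / (disc_bound z + 1)); first by rewrite !divr_gt0.
exists N => // n /= Nn; rewrite sub0r normrN ger0_norm ?nsq_ge0 //.
rewrite -[X in X < _]nsqN opprB -(psum_sub dz ll (lu n)).
have := psum_l2_le dz (l2B ll (lu n)).
have := hN n Nn; rewrite ger0_norm; last by apply: qn_ge0; exact: (l2B ll (lu n)).
rewrite ler_pdivlMr //; have := qn_ge0 (l2B ll (lu n)).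
set Q := qn _; set P := nsq _ => Q0 h1 h2; nra.
Qed.

Variable w : C.
Hypothesis w1 : `|w| < 1.

Let rho1 : nsq w < 1. Proof. by rewrite -normC_lt1. Qed.
Let rho0 : 0 <= nsq w. Proof. exact: nsq_ge0. Qed.

Lemma den_neq0 (z : C) : `|z| <= 1 -> 1 - w^* * z != 0.
Proof.
rewrite normC_le1 => z1; rewrite subr_eq0; apply/eqP => /(congr1 (@nsq R)).
rewrite nsqM nsq_conj {1}/nsq /= expr1n expr0n /= addr0 => h.
by have := nsq_ge0 z; have := rho1; have := rho0; nra.
Qed.

(* [st c a] are the Taylor coefficients of [(c + z a(z)) / (1 - w^* z)]. *)
Fixpoint st (c : C) (a : nat -> C) (n : nat) : C :=
  if n is m.+1 then w^* * st c a m + a m else c.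
(** For [s = (1 - |w|^2) / 2] one has [(1 + s) |w|^2 <= 1 - s], so each step of the recursion
    contracts the squared state by [1 - s] up to a multiple of the input. Summing and absorbing
    leaves [s] times the partial sum on the left. *)
Lemma l2_st c a : l2 a -> l2 (st c a).
Proof.
move=> la; pose s := (1 - nsq w) / 2; have s0 : 0 < s by rewrite divr_gt0 // subr_gt0.
have key N : psq (st c a) N.+1 <=
    nsq c + (1 - s) * psq (st c a) N + (1 + s^-1) * psq a N.
  elim: N => [|N IH]; first by rewrite psqS !psq0 !mulr0 !addr0 add0r.
  rewrite psqS {1}/st -/(st c a N) [psq (st c a) N.+1 in leRHS]psqS [psq a N.+1]psqS.
  have := nsq_tri (w^* * st c a N) (a N) s0; rewrite nsqM nsq_conj mulrA.
  have : (1 + s) * nsq w <= 1 - s by rewrite /s; have := rho0; have := rho1; nra.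
  move=> h1 h2; have h3 := ler_wpM2r (nsq_ge0 (st c a N)) h1.
  move: IH h2 h3; rewrite (mulrDr (1 + s^-1) (psq _ _)) (mulrDr (1 - s) (psq _ _)).
  set A := (1 + s) * _ * _; set B := (1 - s) * nsq _; set D := (1 - s) * psq _ _.
  set E := _ * psq a N; set F := _ * nsq (a N).
  by clearbody A B D E F; lra.
apply: (@l2_bounded _ _ ((nsq c + (1 + s^-1) * qn a) / s) _).1 => N.
rewrite ler_pdivlMr //.
have := key N; have := @psq_ndecr _ (st c a) N N.+1 (leqnSn N).
have s1 : 0 < 1 + s^-1 by rewrite addr_gt0 // invr_gt0.
have := ler_wpM2l (ltW s1) (psq_le N la).
have -> : (1 - s) * psq (st c a) N = psq (st c a) N - psq (st c a) N * s by ring.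
set A := _ * psq a N; set B := _ * qn a; set D := _ * s.
by clearbody A B D; lra.
Qed.

(** The recursion says that the sum [F] satisfies [F = c + z (w^* F + a)], which is solved for
    [F]. *)
Lemma psum_st c a z : disc z -> l2 a ->
  pconv (st c a) z /\ psum (st c a) z = (c + z * psum a z) / (1 - w^* * z).
Proof.
move=> dz la; have ps := pconv_l2 dz (l2_st (c := c) la).
split=> //.
have [pl el] := psum_lin w^* ps (pconv_l2 dz la).
have [_ es] := psum_shift c pl; rewrite el in es.
have E : psum (st c a) z = c + z * (w^* * psum (st c a) z + psum a z).
  by rewrite -es; apply: psum_ext => -[|n].
have d0 := den_neq0 (ltW dz).
apply: (mulIf d0); rewrite divfK // mulrBr mulr1 {1}E; ring.
Qed.

(** From [1 / (1 - w^* z) = 1 + w^* z / (1 - w^* z)], where [st 0 a] represents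
    [z g / (1 - w^* z)]. *)
Lemma inH2_div_den g : inH2 g -> inH2 (fun z => g z / (1 - w^* * z)).
Proof.
move=> [a [la ga]]; exists ((w^* : C) *: (st 0 a : seqC) + a); split.
  exact: (l2D (l2Z (l2_st (c := 0) la)) la).
move=> z dz; have [ps es] := psum_st 0 dz la.
have [_ e] := psum_lin w^* ps (pconv_l2 dz la).
have -> : psum (w^* *: (st 0 a : seqC) + a) z = w^* * psum (st 0 a) z + psum a z.
  by rewrite -e.
have d0 := den_neq0 (ltW dz).
by rewrite es ga //; field.
Qed.

End Resolvent.

(** * Weighted composition with a Moebius map *)

Section Composition.
Variable R : realType.
Local Notation C := (Cplx R).
Local Notation "x %:C" := (real_complex R x : C) (format "x %:C").
Local Notation seqC := (nat -> C^o).
Variables (lam w : C).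
Hypothesis lam1 : `|lam| = 1.
Hypothesis w1 : `|w| < 1.

Let rho1 : nsq w < 1. Proof. by rewrite -normC_lt1. Qed.
Let rho0 : 0 <= nsq w. Proof. exact: nsq_ge0. Qed.
Let nlam : nsq lam = 1. Proof. exact: normC_eq1. Qed.

Definition moebius (z : C) : C := lam * (z - w) / (1 - w^* * z).
(** The function [e] of the overview: up to the factor [lam], the Szegő kernel at [w] times
    [1 - |w|^2]. *)
Definition weight (z : C) : C := lam * (1 - w * w^*) / (1 - w^* * z).

Lemma disc_moebius z : disc z -> disc (moebius z).
Proof.
move=> dz; rewrite /disc normC_lt1 /moebius nsqM nsqM nlam mul1r nsqV.
have d0 : 0 < nsq (1 - w^* * z).
  by rewrite lt_def nsq_ge0 andbT nsq_eq0; apply: den_neq0 => //; exact: ltW.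
rewrite ltr_pdivrMr // mul1r -subr_gt0.
have -> : nsq (1 - w^* * z) - nsq (z - w) = (1 - nsq w) * (1 - nsq z).
  by rewrite conjE; case: (z) (w) => [x y] [u v]; rewrite /nsq /=; ring.
by rewrite mulr_gt0 // subr_gt0 // -normC_lt1.
Qed.

(* The Taylor coefficients of [weight * c + moebius * a], see [psum_out], as the
   output of a linear system with state [st]; the energy balance of that system
   replaces boundary values in the proof that Moebius maps act isometrically. *)
Definition out (c : C) (a : nat -> C) (n : nat) : C :=
  lam * ((1 - w * w^*) * st w c a n - w * a n).

(** Conservation of energy in one time step with state [x] and input [a], where states are weighted
    by [1 - |w|^2]: output plus next state balances input plus current state. *)
Lemma energy_step (x a : C) :
  nsq (lam * ((1 - w * w^*) * x - w * a)) + (1 - nsq w) * nsq (w^* * x + a) =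
  nsq a + (1 - nsq w) * nsq x.
Proof.
rewrite nsqM nlam mul1r !conjE; case: (w) x a => [p q] [x y] [u v].
by rewrite /nsq /=; ring.
Qed.

Lemma energy c a N :
  psq (out c a) N + (1 - nsq w) * nsq (st w c a N) = psq a N + (1 - nsq w) * nsq c.
Proof.
elim: N => [|N IH]; first by rewrite !psq0.
rewrite !psqS -addrA energy_step addrCA IH addrCA; ring.
Qed.

Lemma psq_out_le c a N : psq (out c a) N <= psq a N + (1 - nsq w) * nsq c.
Proof. by rewrite -energy lerDl mulr_ge0 ?nsq_ge0 // subr_ge0 ltW. Qed.

(** The factor of [a(z)] comes from [(1 - |w|^2) z / (1 - w^* z) - w = (z - w) / (1 - w^* z)]. *)
Lemma psum_out c a z : disc z -> l2 a ->
  psum (out c a) z = weight z * c + moebius z * psum a z.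
Proof.
move=> dz la; have [ps es] := psum_st w1 c dz la.
have d0 := den_neq0 w1 (ltW dz).
have [p1 e1] := psum_lin (- (lam * w)) (pconv_l2 dz la) (pconv_l2 dz (@l2_0 R)).
have [_ e2] := psum_lin (lam * (1 - w * w^*)) ps p1.
have -> : psum (out c a) z = lam * (1 - w * w^*) * psum (st w c a) z +
     (- (lam * w) * psum a z + psum (0 : seqC) z).
  rewrite -e1 -e2; apply: psum_ext => n; rewrite /out addr0; ring.
have -> : psum (0 : seqC) z = 0.
  have := psum_sub dz (@l2_0 R) (@l2_0 R); rewrite !subrr.
  by [].
rewrite es /weight /moebius; field.
exact: d0.
Qed.

(* Horner scheme for [weight * \sum_(j < N) p_j moebius^j]. *)
Fixpoint horner_seq (N : nat) (p : nat -> C) : nat -> C :=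
  if N is M.+1 then out (p 0%N) (horner_seq M (fun n => p n.+1)) else fun=> 0.

Lemma psq_recl (p : nat -> C) N : psq p N.+1 = nsq (p 0%N) + psq (fun n => p n.+1) N.
Proof. by rewrite /psq /series /= big_nat_recl. Qed.

(** By the energy balance, each Horner stage adds at most [(1 - |w|^2) |p_0|^2] to the squared norm
    of the inner sequence. *)
Lemma psq_horner_le N p M : psq (horner_seq N p) M <= (1 - nsq w) * psq p N.
Proof.
elim: N p M => [|N IH] p M /=.
  rewrite psq0 mulr0; elim: M => [|M IH]; first by rewrite psq0.
  by rewrite psqS nsq0 addr0.
apply: le_trans (psq_out_le _ _ _) _; rewrite psq_recl (mulrDr _ (nsq (p 0%N))) [leRHS]addrC lerD2r.
exact: IH.
Qed.

Lemma l2_horner N p : l2 (horner_seq N p).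
Proof. exact: (l2_bounded (psq_horner_le N p)).1. Qed.

Lemma psum_horner N p z : disc z ->
  psum (horner_seq N p) z = weight z * series (fun n => p n * moebius z ^+ n) N.
Proof.
move=> dz; elim: N p => [|N IH] p /=.
  rewrite /series /= big_geq // mulr0.
  have := psum_sub dz (@l2_0 R) (@l2_0 R); rewrite !subrr.
  by [].
rewrite (psum_out _ dz (@l2_horner N _)) IH /series /= big_nat_recl // expr0 mulr1 mulrDr.
congr (_ + _); rewrite mulrCA; congr (_ * _); rewrite mulr_sumr.
by apply: eq_bigr => i _; rewrite exprS mulrCA.
Qed.

Lemma st_sub c c' a a' n :
  st w (c - c') (fun n => a n - a' n) n = st w c a n - st w c' a' n.
Proof. by elim: n => //= n ->; ring. Qed.

Lemma horner_sub N (p p' : nat -> C) n :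
  horner_seq N (fun n => p n - p' n) n = horner_seq N p n - horner_seq N p' n.
Proof.
elim: N p p' n => [|N IH] p p' n /=; first by rewrite subr0.
by rewrite /out (funext (IH _ _)) st_sub; ring.
Qed.

Lemma horner_seq0 N n : horner_seq N (fun=> 0) n = 0.
Proof.
have E : (fun _ : nat => (0 : C) - 0) = fun=> 0 by apply/funext => i; rewrite subrr.
by rewrite -{1}E horner_sub subrr.
Qed.

(** Padding with zeros brings two Horner sums to the same length, so that by linearity their
    difference is the Horner sum of a tail of [p]. *)
Lemma horner_trunc N M p n : (N <= M)%N ->
  horner_seq N p n = horner_seq M (fun n => if (n < N)%N then p n else 0) n.
Proof.
elim: N M p n => [|N IH] [|M] p n // NM; first by rewrite horner_seq0.
rewrite /= /out; suff -> : horner_seq N (fun n => p n.+1) =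
  horner_seq M (fun n => if (n.+1 < N.+1)%N then p n.+1 else 0) by [].
by apply/funext => i; exact: (IH M).
Qed.

Lemma psq_tail (p : nat -> C) N M : (N <= M)%N ->
  psq (fun n => p n - (if (n < N)%N then p n else 0)) M = psq p M - psq p N.
Proof.
elim: M => [|M IH]; first by rewrite leqn0 => /eqP ->; rewrite !psq0 subr0.
rewrite leq_eqVlt => /orP[/eqP NM|NM].
  rewrite -NM subrr; have aux K : (K <= N)%N ->
     psq (fun n => p n - (if (n < N)%N then p n else 0)) K = 0.
    elim: K => [|K IHK] KN; first by rewrite psq0.
    by rewrite psqS (IHK (ltnW KN)) KN subrr nsq0 addr0.
  exact: aux.
have NM' : (N <= M)%N := NM.
by rewrite !psqS (IH NM') ltnNge NM' subr0 addrAC.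
Qed.

Lemma qn_horner_sub N M p : l2 p -> (N <= M)%N ->
  qn ((horner_seq M p : seqC) - horner_seq N p) <= qn p - psq p N.
Proof.
move=> lp NM.
have E : (horner_seq M p : seqC) - horner_seq N p =
    horner_seq M (fun n => p n - (if (n < N)%N then p n else 0)).
  by apply/funext => n; rewrite horner_sub -(horner_trunc _ _ NM).
rewrite E; apply: (l2_bounded _).2 => K.
apply: le_trans (psq_horner_le _ _ _) _; rewrite psq_tail //.
have := psq_le M lp; have := psq_ndecr p NM; have := rho0; have := rho1.
by nra.
Qed.

(** The Horner sums are Cauchy, their differences being bounded by tails of [p]. The limit [G] is
    identified pointwise, since l^2 convergence implies convergence at each point of the disc. *)
Lemma weighted_composition p : l2 p ->
  exists2 G, l2 G & forall z, disc z -> psum G z = weight z * psum p (moebius z).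
Proof.
move=> lp; pose u n : seqC := horner_seq n p.
have lu n : l2 (u n) := @l2_horner n p.
have HQ := l2_complete_quadratic R.
have [|G lG uG] := cq_complete HQ lu.
  move=> e e0; have e4 : 0 < e / 4 by rewrite divr_gt0.
  have := cvg_psq lp => /cvgrPdist_lt/(_ _ e4)[N _ hN].
  exists N => m n Nm Nn.
  have k i : (N <= i)%N -> `|qn (u i - u N)| <= e / 4.
    move=> Ni; rewrite ger0_norm; last by apply: qn_ge0; exact: (l2B (lu i) (lu N)).
    apply: le_trans (qn_horner_sub lp Ni) _; apply: ltW.
    exact: le_lt_trans (ler_norm _) (hN N (leqnn N)).
  have := q_quasiB HQ (lu m) (lu N) (lu n).
  have := k _ Nm; have := k _ Nn; rewrite [in X in X -> _](q_sym HQ (lu n) (lu N)).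
  by lra.
exists G => // z dz; have dm := disc_moebius dz.
have h1 := psum_cvg_l2 dz lu lG uG.
have h2 : (fun n => psum (u n) z) @ \oo --> weight z * psum p (moebius z).
  have -> : (fun n => psum (u n) z) =
     fun n => weight z * series (fun n => p n * moebius z ^+ n) n.
    by apply/funext => n; exact: psum_horner.
  exact: (cvgM (cvg_cst _) (psum_cvg (pconv_l2 dm lp))).
by rewrite -(cvg_limC h1) (cvg_limC h2).
Qed.

End Composition.

(** * Boundedness of the composition operator *)

Section Boundedness.
Variable R : realType.
Local Notation C := (Cplx R).
Local Notation "x %:C" := (real_complex R x : C) (format "x %:C").
Local Notation seqC := (nat -> C^o).

Variables (b : nat -> C) (S : (nat -> C) -> (nat -> C)) (phi : C -> C).
Hypothesis sqS : is_sqrt_defect b S.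
Hypothesis phi_disc : forall z, disc z -> disc (phi z).
Hypothesis invS : forall f, inHb S f -> inHb S (f \o phi).

Let l2S a : l2 a -> l2 (S a).
Proof. by case: sqS => h _ _ _ _; exact: h. Qed.

Let S_lin (c : C) (a a' : seqC) : l2 a -> l2 a' ->
  S (c *: a + a') = (c *: (S a : seqC) + (S a' : seqC)).
Proof. by case: sqS => _ h _ _ _; exact: h. Qed.

Let S0 : S (0 : seqC) = (0 : seqC).
Proof.
have := S_lin (-1) (@l2_0 R) (@l2_0 R).
by rewrite scaler0 addr0 scaleN1r addNr.
Qed.

Let S_sub (a a' : seqC) : l2 a -> l2 a' -> S (a - a') = (S a : seqC) - (S a' : seqC).
Proof.
move=> la la'; rewrite addrC -scaleN1r (S_lin _ la' la).
by rewrite scaleN1r addrC.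
Qed.

(** The given constant is complex; comparing real parts gives a real one, and the absolute value
    makes it nonnegative. *)
Let S_bounded : exists2 K : R, 0 <= K & forall a, l2 a -> qn (S a) <= K * qn a.
Proof.
case: sqS => _ _ [M hM] _ _; exists `|complex.Re M| => // a la.
have := hM a la; rewrite (sqsumE la) (sqsumE (l2S la)).
case: M {hM} => x y; rewrite lecE /= => /andP[_]; rewrite mulr0 subr0 => h.
by apply: le_trans h _; rewrite ler_wpM2r ?qn_ge0 // ler_norm.
Qed.

(** A relation rather than a map: [a'] is determined only up to [ker S]. *)
Definition comp_rel (a a' : seqC) :=
  forall z, disc z -> psum (S a') z = psum (S a) (phi z).

Let psumS_sub (a a' : seqC) z : disc z -> l2 a -> l2 a' ->
  psum (S (a - a')) z = psum (S a) z - psum (S a') z.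
Proof.
by move=> dz la la'; rewrite (S_sub la la') (psum_sub dz (l2S la) (l2S la')).
Qed.

Let comp_rel_lin (c : C) (a a' d d' : seqC) : l2 a -> l2 a' -> l2 d -> l2 d' ->
  comp_rel a a' -> comp_rel d d' -> comp_rel (c *: a + d) (c *: a' + d').
Proof.
move=> la la' ld ld' r r' z dz; have dp := phi_disc dz.
rewrite (S_lin c la ld) (S_lin c la' ld').
have [_ e1] := psum_lin c (pconv_l2 dz (l2S la')) (pconv_l2 dz (l2S ld')).
have [_ e2] := psum_lin c (pconv_l2 dp (l2S la)) (pconv_l2 dp (l2S ld)).
rewrite -(r _ dz) -(r' _ dz) in e2; exact: (etrans e1 (esym e2)).
Qed.

(** Both sides of the relation are continuous at fixed [z], as [S] is bounded and so are the
    evaluations at [z] and at [phi z]. *)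
Let comp_rel_closed (l l' : seqC) : l2 l -> l2 l' ->
  (forall e : R, 0 < e -> exists u u' : seqC, [/\ l2 u, l2 u', comp_rel u u',
     `|qn (l - u)| <= e & `|qn (l' - u')| <= e]) -> comp_rel l l'.
Proof.
move=> ll ll' h z dz; have dp := phi_disc dz.
have [K K0 SK] := S_bounded.
apply/eqP; rewrite -subr_eq0 -nsq_eq0 eq_le nsq_ge0 andbT.
set D1 := disc_bound z; set D2 := disc_bound (phi z).
have D10 : 0 <= D1 := disc_bound_ge0 _; have D20 : 0 <= D2 := disc_bound_ge0 _.
pose B : R := 2 * (D1 * K) + 2 * (D2 * K).
have B0 : 0 <= B by apply: addr_ge0; apply: mulr_ge0 => //; exact: mulr_ge0.
suff key (e : R) : 0 < e -> nsq (psum (S l') z - psum (S l) (phi z)) <= B * e.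
  suff key2 (e : R) : 0 < e -> nsq (psum (S l') z - psum (S l) (phi z)) <= 0 + e.
    exact/ler_addgt0Pr.
  move=> e0; have B1 : 0 < B + 1 by rewrite ltr_wpDl.
  have eB : 0 < e / (B + 1) by rewrite divr_gt0.
  apply: le_trans (key _ eB) _; rewrite add0r mulrCA ger_pMr //.
  by rewrite ler_pdivrMr // mul1r lerDl.
move=> e0; have [u [u' [lu lu' r qu qu']]] := h e e0.
have -> : psum (S l') z - psum (S l) (phi z) =
    psum (S (l' - u')) z - psum (S (l - u)) (phi z).
  by rewrite (psumS_sub dz ll' lu') (psumS_sub dp ll lu) (r _ dz) opprB addrA subrK.
have lb := l2B ll lu; have lb' := l2B ll' lu'.
apply: le_trans (nsqD_le _ _) _; rewrite nsqN.
have side (d : seqC) y : disc y -> l2 d -> `|qn d| <= e ->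
    nsq (psum (S d) y) <= disc_bound y * K * e.
  move=> dy ld; rewrite ger0_norm ?qn_ge0 // => qd.
  apply: le_trans (psum_l2_le dy (l2S ld)) _.
  rewrite -mulrA ler_wpM2l ?disc_bound_ge0 //.
  by apply: le_trans (SK _ ld) _; rewrite ler_wpM2l.
have h1 := side _ _ dz lb' qu'; have h2 := side _ _ dp lb qu.
have -> : B * e = 2 * (D1 * K * e) + 2 * (D2 * K * e) by rewrite /B; ring.
by apply: lerD; rewrite ler_pM2l.
Qed.

Let comp_rel_total (a : seqC) : l2 a -> exists2 a' : seqC, l2 a' & comp_rel a a'.
Proof.
move=> la; have [|a' [la' h]] := invS (f := psum (S a)).
  by exists a; split.
by exists a'; [exact: la'|move=> z dz; exact: (esym (h z dz))].
Qed.

Lemma Cphi_bounded_of_invariant : Cphi_bounded_Hb S phi.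
Proof.
have HQ := l2_complete_quadratic R.
have r0 : comp_rel 0 0.
  move=> z dz; have dp := phi_disc dz.
  have e y : disc y -> psum (S (0 : seqC)) y = 0.
    move=> dy; have := psumS_sub dy (@l2_0 R) (@l2_0 R).
    by rewrite subrr => ->; rewrite subrr.
  by rewrite (e _ dz) (e _ dp).
have [M M0 hM] := closed_relation_bounded HQ r0 comp_rel_lin comp_rel_closed comp_rel_total.
exists M%:C; split; first by rewrite ler0c.
move=> a la _; have [y [ly ry qy]] := hM a la.
have [v [lv rv qv minv]] :=
  exists_minimal_rep HQ r0 comp_rel_lin comp_rel_closed la ly ry.
exists v; split; [exact: lv| |exact: rv|].
(* Every multiple of [k] in [ker S] is related to 0, so minimality of [v] gives
   [qn v <= qn (v + t k)] for all [t], which is orthogonality. *)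
- move=> k lk Sk; apply: inner_minimal => // t.
  have lt : l2 (t *: (k : seqC)) := l2Z lk.
  have rt : comp_rel 0 (t *: (k : seqC)).
    have := comp_rel_lin t (@l2_0 R) lk (@l2_0 R) (@l2_0 R) _ r0.
    rewrite scaler0 !addr0; apply; move=> z dz.
    have E : S k = S (0 : seqC) by apply/funext => i; rewrite Sk S0.
    rewrite E; exact: (r0 z dz).
  have := minv _ lt rt.
  rewrite (ger0_norm (qn_ge0 lv)) (ger0_norm (qn_ge0 (l2D lv lt))); exact.
- rewrite (sqsumE lv) (sqsumE la) -rmorphM /= lecR.
  have := le_trans qv qy.
  by rewrite (ger0_norm (qn_ge0 lv)) (ger0_norm (qn_ge0 la)).
Qed.

End Boundedness.

(** * Invariance of the two model spaces *)

Section Automorphisms.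
Variable R : realType.
Local Notation C := (Cplx R).
Local Notation seqC := (nat -> C^o).

Lemma inH2_affine (c d : C) g : inH2 g -> inH2 (fun z => c * g z + d).
Proof.
move=> [a [la ga]].
have l0 : l2 (pshift d (0 : seqC)).
  apply: (@l2_bounded _ _ (nsq d) _).1; elim=> [|[|N] IH].
  - by rewrite psq0 nsq_ge0.
  - by rewrite psqS psq0 add0r.
  - by rewrite psqS /= nsq0 addr0.
exists (c *: (a : seqC) + (pshift d (0 : seqC) : seqC)); split.
  exact: (l2D (l2Z la) l0).
move=> z dz.
have [_ e] := psum_lin c (pconv_l2 dz la) (pconv_l2 dz l0).
have [_ e0] := psum_shift d (pconv_l2 dz (@l2_0 R)).
have z0 : psum (0 : seqC) z = 0.
  by have := psum_sub dz (@l2_0 R) (@l2_0 R); rewrite !subrr.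
by rewrite [RHS]e e0 z0 mulr0 addr0 (ga _ dz).
Qed.

(** When [xi] is fixed the left side is [moebius lam w z - xi], so this trades the factor of [f] at
    the image point for [z - xi] times the weight. *)
Lemma moebius_diff (lam w z xi : C) : `|w| < 1 -> `|z| <= 1 -> `|xi| <= 1 ->
  moebius lam w z - moebius lam w xi =
  (z - xi) * weight lam w z * (1 - w^* * xi)^-1.
Proof.
move=> w1 z1 xi1; have dz := den_neq0 w1 z1; have dx := den_neq0 w1 xi1.
by rewrite /moebius /weight; field; rewrite dz dx.
Qed.

(** The fixed points are the roots of [w^* x^2 + (lam - 1) x - lam w]. The facts [s] and [t] are the
    Vieta relations; the first is obtained by subtracting the two equations and cancelling
    [xi1 - xi2]. *)
Lemma moebius_sub_id (lam w z xi1 xi2 : C) :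
  `|w| < 1 -> `|z| <= 1 -> `|xi1| <= 1 -> `|xi2| <= 1 -> xi1 != xi2 ->
  moebius lam w xi1 = xi1 -> moebius lam w xi2 = xi2 ->
  moebius lam w z = z + (z - xi1) * (z - xi2) * (w^* / (1 - w^* * z)).
Proof.
move=> w1 z1 x1 x2 ne f1 f2.
have dz := den_neq0 w1 z1; have d1 := den_neq0 w1 x1; have d2 := den_neq0 w1 x2.
have p1 : lam * (xi1 - w) = xi1 * (1 - w^* * xi1) by rewrite -{2}f1 /moebius divfK.
have p2 : lam * (xi2 - w) = xi2 * (1 - w^* * xi2) by rewrite -{2}f2 /moebius divfK.
have s : lam = 1 - w^* * (xi1 + xi2).
  have ne' : xi1 - xi2 != 0 by rewrite subr_eq0.
  apply: (mulfI ne').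
  have -> : (xi1 - xi2) * lam = lam * (xi1 - w) - lam * (xi2 - w) by ring.
  by rewrite p1 p2; ring.
have t : lam * w = - (w^* * (xi1 * xi2)).
  have -> : lam * w = lam * xi1 - lam * (xi1 - w) by ring.
  by rewrite p1 s; ring.
apply: (mulIf dz); rewrite /moebius divfK // mulrDl.
rewrite -[_ * (w^* / _) * _]mulrA divfK // mulrBr t s; ring.
Qed.

Lemma parabolic_invariant (phi : C -> C) (xi : C) f :
  parabolic_aut phi xi -> shift1_space xi f -> shift1_space xi (f \o phi).
Proof.
move=> [[lam [w [lam1 w1 phiE]]] _ xi1 fixP] [g [c [[p [lp gp]] fE]]].
have [G lG GE] := weighted_composition lam1 w1 lp.
have x1 : `|xi| <= 1 by rewrite xi1.
have fx : moebius lam w xi = xi by rewrite /moebius -phiE //; apply/(fixP _ x1).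
(* Here [G] is the weight times [g o phi]; the weight comes from [phi z - xi], and the constant part
   is unchanged. *)
exists (fun z => (1 - w^* * xi)^-1 * psum G z + 0), c; split.
  by apply: inH2_affine; exists G.
move=> z dz; have z1 : `|z| <= 1 := ltW dz.
have pz : phi z = moebius lam w z by rewrite phiE.
have dp := disc_moebius lam1 w1 dz.
rewrite /= pz (fE _ dp) (gp _ dp) (GE _ dz) -{1}fx.
rewrite (moebius_diff _ w1 z1 x1).
by move: (psum p _) (weight _ _ _) (_^-1) => P W I; ring.
Qed.

Lemma hyperbolic_invariant (phi : C -> C) (xi1 xi2 : C) f :
  hyperbolic_aut phi xi1 xi2 -> shift2_space xi1 xi2 f ->
  shift2_space xi1 xi2 (f \o phi).
Proof.
move=> [[lam [w [lam1 w1 phiE]]] ne [n1 n2] fixP] [g [c0 [c1 [[p [lp gp]] fE]]]].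
have [G lG GE] := weighted_composition lam1 w1 lp.
have x1 : `|xi1| <= 1 by rewrite n1.
have x2 : `|xi2| <= 1 by rewrite n2.
have f1 : moebius lam w xi1 = xi1.
  by rewrite /moebius -phiE //; apply/(fixP _ x1); left.
have f2 : moebius lam w xi2 = xi2.
  by rewrite /moebius -phiE //; apply/(fixP _ x2); right.
(* The factors at [xi1] and [xi2] produce two weights. One is absorbed into [G], the other leaves
   its numerator in [k] and the denominator [1 - w^* z] in the witness. The summand [c1 * w^*] comes
   from [c1 * (phi z - z)]. *)
pose k := (1 - w^* * xi1)^-1 * (1 - w^* * xi2)^-1 * (lam * (1 - w * w^*)).
exists (fun z => (k * psum G z + c1 * w^*) / (1 - w^* * z)), c0, c1; split.
  by apply: (inH2_div_den w1); apply: inH2_affine; exists G.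
move=> z dz; have z1 : `|z| <= 1 := ltW dz.
have pz : phi z = moebius lam w z by rewrite phiE.
have dp := disc_moebius lam1 w1 dz.
rewrite /= pz (fE _ dp) (gp _ dp) (GE _ dz).
rewrite -{1}f1 -{1}f2 (moebius_diff _ w1 z1 x1) (moebius_diff _ w1 z1 x2).
rewrite [X in c1 * X](moebius_sub_id w1 z1 x1 x2 ne f1 f2).
have d0 := den_neq0 w1 z1.
move: (psum p _) => P; rewrite /k /weight.
move: (1 - w^* * xi1)^-1 (1 - w^* * xi2)^-1 => i1 i2.
by field.
Qed.

Lemma inHb_invariant (S : (nat -> C) -> (nat -> C)) (X : (C -> C) -> Prop) phi :
  (forall f, inHb S f <-> X f) -> (forall f, X f -> X (f \o phi)) ->
  forall f, inHb S f -> inHb S (f \o phi).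
Proof. by move=> SX Xphi f /SX/Xphi/SX. Qed.

Lemma disc_aut_disc (phi : C -> C) : disc_aut phi ->
  forall z, disc z -> disc (phi z).
Proof.
move=> [lam [w [lam1 w1 phiE]]] z dz; rewrite phiE ?ltW //.
exact: disc_moebius.
Qed.

End Automorphisms.

Theorem theorem4p5 (R : realType) :
  (forall (b : nat -> Cplx R) (S : (nat -> Cplx R) -> (nat -> Cplx R))
          (phi : Cplx R -> Cplx R) (xi : Cplx R),
      Hinf_ball b -> is_sqrt_defect b S -> parabolic_aut phi xi ->
      (forall f, inHb S f <-> shift1_space xi f) ->
      Cphi_bounded_Hb S phi) /\
  (forall (b : nat -> Cplx R) (S : (nat -> Cplx R) -> (nat -> Cplx R))
          (phi : Cplx R -> Cplx R) (xi1 xi2 : Cplx R),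
      Hinf_ball b -> is_sqrt_defect b S -> hyperbolic_aut phi xi1 xi2 ->
      (forall f, inHb S f <-> shift2_space xi1 xi2 f) ->
      Cphi_bounded_Hb S phi).
Proof.
split.
- move=> b S phi xi _ sqS aut HbE; apply: (Cphi_bounded_of_invariant sqS).
    by apply: disc_aut_disc; case: aut.
  by apply: (inHb_invariant HbE) => f; exact: parabolic_invariant.
- move=> b S phi xi1 xi2 _ sqS aut HbE; apply: (Cphi_bounded_of_invariant sqS).
    by apply: disc_aut_disc; case: aut.
  by apply: (inHb_invariant HbE) => f; exact: hyperbolic_invariant.
Qed.
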